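(* $\mathcal{F}_{s}$ is an over radical in $\overline{\mathbf{L}}$.
   Context: A Banach Lie algebra is a complex Lie algebra $\mathcal{L}$ which is a Banach space in some norm such that, for some constant $t_{\mathcal{L}}>0$, $\|[a,b]\|\leq t_{\mathcal{L}}\|a\|\|b\|$ for all $a,b\in\mathcal{L}$. $\overline{\mathbf{L}}$ is the category of all Banach Lie algebras whose morphisms are bounded Lie homomorphisms with dense image. A map $R$ that sends each Banach Lie algebra $\mathcal{L}$ to a closed Lie ideal $R(\mathcal{L})$ of $\mathcal{L}$ is a preradical in $\overline{\mathbf{L}}$ if $f(R(\mathcal{L}))\subseteq R(\mathcal{M})$ for each morphism $f:\mathcal{L}\to\mathcal{M}$ in $\overline{\mathbf{L}}$. It is upper stable if $R(\mathcal{L}/R(\mathcal{L}))=\{0\}$ for all $\mathcal{L}$, and balanced if $R(I)\subseteq R(\mathcal{L})$ for every closed Lie ideal $I$ of every $\mathcal{L}$. An over radical is an upper stable balanced preradical. For a non-empty family $G$ of closed subspaces of a Banach space put $\mathfrak{p}(G)=\bigcap_{Y\in G}Y$ and $\mathfrak{s}(G)=\overline{\sum_{Y\in G}Y}$. $G$ is complete if $\mathfrak{p}(G')\in G$ and $\mathfrak{s}(G')\in G$ for every $\varnothing\neq G'\subseteq G$. $G$ is a lower finite-gap family if for each $Z\in G$ with $Z\neq\mathfrak{p}(G)$ there is $Y\in G$ with $Y\subset Z$ and $0<\dim(Z/Y)<\infty$. A chain is a family of closed subspaces linearly ordered by inclusion; a complete chain $C$ is between $V$ and $W$ if $\mathfrak{p}(C)=V$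 and $\mathfrak{s}(C)=W$. $\mathcal{L}$ is strongly $\mathcal{F}$-semisimple if there is a complete, lower finite-gap chain of closed Lie ideals of $\mathcal{L}$ between $\{0\}$ and $\mathcal{L}$. A closed Lie ideal $I$ of $\mathcal{L}$ is strongly $\mathcal{F}$-primitive if $\mathcal{L}/I$ is strongly $\mathcal{F}$-semisimple. $\mathcal{F}_{s}(\mathcal{L})$ is the intersection of all strongly $\mathcal{F}$-primitive Lie ideals of $\mathcal{L}$. *)

(* Defs.v *)
From HB Require Import structures.
From mathcomp Require Import all_boot all_order all_algebra.
From mathcomp Require Import generic_quotient ring_quotient.
From mathcomp Require Import complex.
From mathcomp Require Import boolp classical_sets reals topology.
From mathcomp Require Import normedtype.

Set Implicit Arguments.
Unset Strict Implicit.
Unset Printing Implicit Defensive.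

Import Order.TTheory GRing.Theory Num.Theory.
Import numFieldNormedType.Exports.

Local Open Scope classical_set_scope.
Local Open Scope complex_scope.
Local Open Scope ring_scope.

(* The complex numbers are [R[i]] for [R : realType]; norms of normed
   [R[i]]-modules take their values in [R[i]], where [0 <= x] forces [x] to be
   real. *)
HB.mixin Record isBanachLie (R : realType) (L : Type)
    & CompleteNormedModule R[i] L := {
  lie : L -> L -> L;
  lie_linearl : forall z, linear (lie ^~ z);
  lie_linearr : forall z, linear (lie z);
  lie_alt : forall x, lie x x = 0;
  lie_jacobi : forall x y z,
    lie x (lie y z) + lie y (lie z x) + lie z (lie x y) = 0;
  lie_bounded : exists2 t : R[i], 0 < t &
    forall x y, `|lie x y| <= t * `|x| * `|y|
}.

#[short(type="banachLieType")]
HB.structure Definition BanachLie (R : realType) :=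
  {L of CompleteNormedModule R[i] L & isBanachLie R L}.

Section Subspaces.
Context {R : realType} {V : completeNormedModType R[i]}.

Definition subspace (A : set V) : Prop :=
  A 0 /\ forall (a : R[i]) x y, A x -> A y -> A (a *: x + y).

Definition closed_subspace (A : set V) : Prop := subspace A /\ closed A.

End Subspaces.

Section Ideals.
Context {R : realType}.

Definition closed_lie_ideal {L : banachLieType R} (I : set L) : Prop :=
  closed_subspace I /\ forall a x, I x -> I (lie a x).

Record closedIdeal (L : banachLieType R) := ClosedIdeal {
  ideal_set : set L;
  ideal_setP : closed_lie_ideal ideal_set
}.

End Ideals.
Arguments ClosedIdeal {R L}.

Section IdealPred.
Context {R : realType} {L : banachLieType R} (I : closedIdeal L).

(* Boolean copy of [ideal_set I], as the algebraic closure structures need. *)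
Definition ideal_pred : L -> bool := fun x => x \in ideal_set I.

Lemma ideal_predP x : (x \in ideal_pred) <-> ideal_set I x.
Proof. by split=> [/set_mem|/mem_set]. Qed.

Lemma ideal_submod_closed : submod_closed ideal_pred.
Proof.
have [[[I0 ID] _] _] := ideal_setP I.
split; first exact/ideal_predP.
by move=> a x y /ideal_predP xI /ideal_predP yI; apply/ideal_predP/ID.
Qed.

HB.instance Definition _ :=
  GRing.isSubmodClosed.Build R[i] L ideal_pred ideal_submod_closed.

End IdealPred.

Section IdealAlgebra.
Context {R : realType} {L : banachLieType R} (I : closedIdeal L).

(* The closed ideal [I] as a Banach Lie algebra, with the norm and bracket of
   [L]. *)
Definition idealLie : Type := {x : L | x \in ideal_pred I}.

HB.instance Definition _ := SubChoice.on idealLie.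
HB.instance Definition _ := [SubChoice_isSubLmodule of idealLie by <:].

Let subnorm (x : idealLie) : R[i] := `|val x|.

Let subnormD x y : subnorm (x + y) <= subnorm x + subnorm y.
Proof. by rewrite /subnorm raddfD ler_normD. Qed.

Let subnormZ (a : R[i]) x : subnorm (a *: x) = `|a| * subnorm x.
Proof. by rewrite /subnorm linearZ normrZ. Qed.

Let subnorm0 x : subnorm x = 0 -> x = 0.
Proof. by move/normr0_eq0 => x0; apply: val_inj; rewrite x0 raddf0. Qed.

HB.instance Definition _ :=
  Lmodule_isNormed.Build R[i] idealLie subnormD subnormZ subnorm0.

Lemma idealLie_normE (x : idealLie) : `|x| = `|val x|.
Proof. by []. Qed.

Let sub_complete (F : set_system idealLie) :
  ProperFilter F -> cauchy F -> cvg F.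
Proof.
move=> FF /cauchyP Fc.
have Gc : cauchy (val @ F : set_system L).
  apply/cauchyP => e e0; have [x Fx] := Fc e e0; exists (val x).
  apply: (@filterS _ F _ (ball x e)) => // y.
  by rewrite -!ball_normE /ball_ /= idealLie_normE raddfB.
have /cvg_ex[l lP] : cvg (val @ F : set_system L) by exact/cauchy_cvgP.
have lI : ideal_set I l.
  apply: (@closed_cvg _ _ F _ val (ideal_set I) (ideal_setP I).1.2 _ l lP).
  by apply: nearW => x; apply/ideal_predP; exact: valP.
have lI' : l \in ideal_pred I by apply/ideal_predP.
apply/cvg_ex; exists (exist _ l lI' : idealLie).
apply/(@cvg_ballP R[i] idealLie _ F _ id) => e e0.
move/cvg_ballP : lP => /(_ e e0); apply: filterS => x.
by rewrite -!ball_normE /ball_ /= idealLie_normE raddfB.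
Qed.

HB.instance Definition _ := Uniform_isComplete.Build idealLie sub_complete.

Let sublie_subproof (x y : idealLie) : lie (val x) (val y) \in ideal_pred I.
Proof.
by apply/ideal_predP/(ideal_setP I).2/ideal_predP; exact: valP.
Qed.

Definition sublie (x y : idealLie) : idealLie :=
  exist _ (lie (val x) (val y)) (sublie_subproof x y).

Let sublie_linearl z : linear (sublie ^~ z).
Proof.
move=> a x y; apply: val_inj.
exact: (lie_linearl (val z) a (val x) (val y)).
Qed.

Let sublie_linearr z : linear (sublie z).
Proof.
move=> a x y; apply: val_inj.
exact: (lie_linearr (val z) a (val x) (val y)).
Qed.

Let sublie_alt x : sublie x x = 0.
Proof. by apply: val_inj; rewrite /= lie_alt. Qed.

Let sublie_jacobi x y z :
  sublie x (sublie y z) + sublie y (sublie z x) + sublie z (sublie x y) = 0.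
Proof. by apply: val_inj; rewrite !raddfD /= lie_jacobi. Qed.

Let sublie_bounded : exists2 t : R[i], 0 < t &
  forall x y, `|sublie x y| <= t * `|x| * `|y|.
Proof. by have [t t0 tP] := @lie_bounded R L; exists t => // x y; exact: tP. Qed.

HB.instance Definition _ := isBanachLie.Build R idealLie
  sublie_linearl sublie_linearr sublie_alt sublie_jacobi sublie_bounded.

End IdealAlgebra.

Lemma half_lt {R : realType} (e : R[i]) : 0 < e ->
  exists n, (2^-1 : R[i]) ^+ n < e.
Proof.
move=> e0; have eE : (complex.Re e)%:C = e by rewrite RRe_real // gtr0_real.
have re0 : 0 < complex.Re e by rewrite -ltcR eE.
exists (Num.Def.archi_bound (complex.Re e)^-1).
set n := Num.Def.archi_bound _.
have h : (complex.Re e)^-1 < (2 ^ n)%:R.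
  apply: lt_trans (archi_boundP _) _; first by rewrite invr_ge0 ltW.
  by rewrite ltr_nat ltn_expl.
rewrite exprVn -natrX -eE.
have -> : ((2 ^ n)%:R : R[i]) = ((2 ^ n)%:R : R)%:C by rewrite rmorph_nat.
by rewrite -fmorphV ltcR invf_plt ?posrE // ltr0n expn_gt0.
Qed.

Section QuotientAlgebra.
Context {R : realType} {L : banachLieType R} (I : closedIdeal L).

Local Notation idealz := (GRing.ZmodClosed.clone L (ideal_pred I) _).

(* L / I, with the usual quotient norm [qnorm] and the bracket [qlie] of
   cosets. *)
Definition quotLie : Type := Quotient.quot idealz.

HB.instance Definition _ := GRing.Zmodule.on quotLie.

Definition qpi (x : L) : quotLie := (\pi_(Quotient.quot idealz) x)%qT.

Let qrepr (q : quotLie) : L := repr (q : Quotient.quot idealz).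

Let qreprK q : qpi (qrepr q) = q.
Proof. exact: reprK. Qed.

Lemma qpiP x y : qpi x = qpi y <-> ideal_set I (x - y).
Proof.
rewrite -ideal_predP; split=> [/eqP|h].
  by rewrite -Quotient.idealrBE.
by apply/eqP; rewrite -Quotient.idealrBE.
Qed.

Lemma qpi_surj q : exists x, qpi x = q.
Proof. by exists (qrepr q). Qed.

Lemma qpiD x y : qpi (x + y) = qpi x + qpi y.
Proof. exact: raddfD. Qed.

Let idealZ a x : ideal_set I x -> ideal_set I (a *: x).
Proof.
have [[[I0 ID] _] _] := ideal_setP I.
by move=> xI; rewrite -[_ *: _]addr0; exact: ID.
Qed.

Let idealD x y : ideal_set I x -> ideal_set I y -> ideal_set I (x + y).
Proof.
have [[[I0 ID] _] _] := ideal_setP I.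
by move=> xI yI; rewrite -[x]scale1r; exact: ID.
Qed.

Let qscale (a : R[i]) (q : quotLie) : quotLie := qpi (a *: qrepr q).

Let qscaleE a x : qscale a (qpi x) = qpi (a *: x).
Proof.
by apply/qpiP; rewrite -scalerBr; apply: idealZ; apply/qpiP; rewrite qreprK.
Qed.

Let qscaleA a b q : qscale a (qscale b q) = qscale (a * b) q.
Proof. by have [x <-] := qpi_surj q; rewrite !qscaleE scalerA. Qed.

Let qscale1 : left_id 1 qscale.
Proof. by move=> q; have [x <-] := qpi_surj q; rewrite !qscaleE scale1r. Qed.

Let qscaleDr : right_distributive qscale +%R.
Proof.
move=> a p q; have [x <-] := qpi_surj p; have [y <-] := qpi_surj q.
by rewrite -qpiD !qscaleE scalerDr qpiD.
Qed.

Let qscaleDl q : {morph qscale^~ q : a b / a + b}.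
Proof.
by move=> a b; have [x <-] := qpi_surj q; rewrite !qscaleE scalerDl qpiD.
Qed.

HB.instance Definition _ := GRing.Zmodule_isLmodule.Build R[i] quotLie
  qscaleA qscale1 qscaleDr qscaleDl.

Lemma qpiZ a x : qpi (a *: x) = a *: qpi x.
Proof. by rewrite -qscaleE. Qed.

Let qpi0 : qpi 0 = 0.
Proof. by have := qpiZ 0 0; rewrite !scale0r. Qed.

Lemma qpiB x y : qpi (x - y) = qpi x - qpi y.
Proof. by rewrite qpiD -scaleN1r qpiZ scaleN1r. Qed.

Let n (x : L) : R := complex.Re `|x|.

Let nE x : `|x| = (n x)%:C.
Proof. by rewrite /n RRe_real ?normr_real. Qed.

Let n_ge0 x : 0 <= n x.
Proof. by rewrite -lecR -nE; exact: normr_ge0. Qed.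

Definition coset_norms (q : quotLie) : set R :=
  [set complex.Re `|x| | x in [set x | qpi x = q]].

Definition qnorm (q : quotLie) : R[i] := (inf (coset_norms q))%:C.

Let qn q := inf (coset_norms q).

Let has_inf_norms q : has_inf (coset_norms q).
Proof.
split; first by exists (n (qrepr q)), (qrepr q) => //=; exact: qreprK.
by exists 0 => _ [x _ <-]; exact: n_ge0.
Qed.

Let qn_ge0 q : 0 <= qn q.
Proof.
apply: lb_le_inf; first by have [] := has_inf_norms q.
by move=> _ [x _ <-]; exact: n_ge0.
Qed.

Let qn_le x : qn (qpi x) <= n x.
Proof. by apply: ge_inf; [have [] := has_inf_norms (qpi x)|exists x]. Qed.

Let qn_adh q e : 0 < e -> exists2 x, qpi x = q & n x < qn q + e.
Proof. by move/inf_adherent => /(_ _ (has_inf_norms q))[_ [x qx <-]]; exists x. Qed.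

Let nD x y : n (x + y) <= n x + n y.
Proof. by rewrite -lecR rmorphD /= -!nE ler_normD. Qed.

Let nZ a x : n (a *: x) = complex.Re `|a| * n x.
Proof.
have aE : `|a| = (complex.Re `|a|)%:C by rewrite RRe_real ?normr_real.
by rewrite {1}/n normrZ {1}aE nE -rmorphM.
Qed.

Let qnormD p q : qnorm (p + q) <= qnorm p + qnorm q.
Proof.
rewrite /qnorm -rmorphD lecR; apply/ler_addgt0Pr => e e0.
have e20 : 0 < e / 2 by rewrite divr_gt0.
have [x <- xp] := qn_adh p e20; have [y <- yq] := qn_adh q e20.
rewrite -qpiD; apply: le_trans (qn_le _) _; apply: le_trans (nD _ _) _.
by rewrite [e]splitr addrACA lerD // ltW.
Qed.

Let qnormZ_le a q : qn (a *: q) <= complex.Re `|a| * qn q.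
Proof.
have a0 : 0 <= complex.Re `|a| by rewrite -lecR RRe_real ?normr_real //; exact: normr_ge0.
apply/ler_addgt0Pr => e e0.
have a1 : 0 < complex.Re `|a| + 1 by rewrite ltr_wpDl.
have e10 : 0 < e / (complex.Re `|a| + 1) by rewrite divr_gt0.
have [x <- xq] := qn_adh q e10.
rewrite -qpiZ; apply: le_trans (qn_le _) _; rewrite nZ.
apply: (@le_trans _ _ (complex.Re `|a| * (qn (qpi x) + e / (complex.Re `|a| + 1)))).
  by rewrite ler_wpM2l // ltW.
rewrite mulrDr lerD2l mulrCA ler_piMr ?(ltW e0) // ler_pdivrMr // mul1r.
by rewrite lerDl.
Qed.

Let qnormZ a q : qnorm (a *: q) = `|a| * qnorm q.
Proof.
rewrite /qnorm -[`|a|]RRe_real ?normr_real // -rmorphM; congr (_%:C).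
have [->|a0] := eqVneq a 0.
  rewrite scale0r normr0 mul0r; apply/eqP; rewrite eq_le qn_ge0 andbT.
  rewrite -qpi0; apply: le_trans (qn_le _) _.
  by rewrite /n normr0.
apply/eqP; rewrite eq_le qnormZ_le /=.
have := qnormZ_le a^-1 (a *: q); rewrite scalerA mulVf // scale1r => h.
have ra0 : 0 < complex.Re `|a| by rewrite -ltcR RRe_real ?normr_real //; move: a0; rewrite -normr_gt0.
rewrite -ler_pdivlMl //; apply: le_trans h _.
by rewrite normfV -[`|a|]RRe_real ?normr_real // -fmorphV /=.
Qed.

Let qnorm0 q : qnorm q = 0 -> q = 0.
Proof.
move/complexI => q0.
rewrite -[q]qreprK -[in RHS]qpi0; apply/qpiP; rewrite subr0.
have /closure_id -> := (ideal_setP I).1.2.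
move=> B /nbhs_ballP[e /= e0 eB].
have eE : (complex.Re e)%:C = e by rewrite RRe_real // gtr0_real.
have re0 : 0 < complex.Re e by rewrite -ltcR eE.
have [x qx xe] := qn_adh q re0.
exists (qrepr q - x); split.
  by apply/qpiP; rewrite qreprK.
apply: eB; rewrite -ball_normE /ball_ /= subKr nE -eE ltcR.
by move: xe; rewrite /qn q0 add0r.
Qed.

HB.instance Definition _ :=
  Lmodule_isNormed.Build R[i] quotLie qnormD qnormZ qnorm0.

Lemma quotLie_normE (q : quotLie) : `|q| = qnorm q.
Proof. by []. Qed.

Lemma qpi_norm x : `|qpi x| <= `|x|.
Proof. by rewrite quotLie_normE nE lecR qn_le. Qed.

Lemma qpi_lift q : exists2 x, qpi x = q & `|x| <= 2 * `|q|.
Proof.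
have [->|q0] := eqVneq q 0.
  by exists 0; rewrite ?qpi0 // !normr0 mulr0.
have qn0 : 0 < qn q.
  by rewrite -ltcR -/(qnorm q) -quotLie_normE; move: q0; rewrite -normr_gt0.
have [x qx xq] := qn_adh q qn0; exists x => //.
rewrite quotLie_normE nE /qnorm mulr_natl mulr2n -rmorphD lecR.
exact: ltW xq.
Qed.

Let quot_complete (F : set_system quotLie) :
  ProperFilter F -> cauchy F -> cvg F.
Proof.
move=> FF /cauchyP Fc.
pose h k : R[i] := 2^-1 ^+ k.
have h0 k : 0 < h k by rewrite exprn_gt0 // invr_gt0.
have hS k : h k = 2 * h k.+1 by rewrite /h exprS mulrA mulfV ?mul1r ?pnatr_eq0.
have [q qF] : exists q : nat -> quotLie, forall k, F (ball (q k) (h k)).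
  by have /choice[q qP] := fun k => Fc (h k) (h0 k); exists q.
have qS k : `|q k.+1 - q k| <= 2 * h k.
  have [y []] := @filter_ex _ _ FF _ (filterI (qF k) (qF k.+1)).
  rewrite -!ball_normE /ball_ /= => y1 y2.
  rewrite -[_ - _](subrKA y); apply: le_trans (ler_normD _ _) _.
  rewrite mulr_natl mulr2n lerD //; last by rewrite distrC ltW.
  by rewrite (le_trans (ltW y2)) // (hS k) ler_peMl ?ler1n // ltW.
have /choice[l lP] : forall p : quotLie,
    exists x : L, qpi x = p /\ `|x| <= 2 * `|p|.
  by move=> p; have [x ? ?] := qpi_lift p; exists x.
pose x := fix x k := if k is k'.+1 then x k' + l (q k'.+1 - q k') else l (q 0%N).
have xq k : qpi (x k) = q k.
  elim: k => [|k IH] /=; first by have [] := lP (q 0%N).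
  by rewrite qpiD IH (lP _).1 addrC subrK.
have xS k : `|x k.+1 - x k| <= 4 * h k.
  rewrite /= addrC addKr; apply: le_trans (lP _).2 _.
  have -> : 4 = 2 * 2 :> R[i] by rewrite -natrM.
  rewrite -mulrA.
  by rewrite ler_wpM2l //; exact: qS.
have xD k j : `|x (k + j)%N - x k| <= 8 * h k - 8 * h (k + j)%N.
  elim: j => [|j IH]; first by rewrite addn0 !subrr normr0.
  rewrite addnS -[_ - _](subrKA (x (k + j)%N)); apply: le_trans (ler_normD _ _) _.
  apply: le_trans (lerD (xS _) IH) _.
  rewrite addrCA lerD2l.
  have -> : 8 = 4 * 2 :> R[i] by rewrite -natrM.
  rewrite -!mulrA -hS [2 * _]mulr_natl mulr2n mulrDr opprD.
  by rewrite addrA subrr add0r.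
have xc : cauchy (x k @[k --> \oo] : set_system L).
  apply/cauchyP => e e0.
  have [k ke] := @half_lt R (e / 8) (divr_gt0 e0 (ltr0Sn _ _)).
  exists (x k); exists k => // j /= kj.
  rewrite -ball_normE /ball_ /= distrC -(subnKC kj).
  apply: le_lt_trans (xD _ _) _.
  apply: (@le_lt_trans _ _ (8 * h k)); first by rewrite gerBl mulr_ge0 // ltW.
  by rewrite mulrC -ltr_pdivlMr.
have /cvg_ex[z zP] : cvg (x k @[k --> \oo] : set_system L) by exact/cauchy_cvgP.
apply/cvg_ex; exists (qpi z).
apply/(@cvg_ballP R[i] quotLie _ F _ id) => e e0.
have e20 : 0 < e / 2 by rewrite divr_gt0.
have [k0 k0e] := half_lt e20.
move/cvg_ballP : zP => /(_ _ e20)[k1 _ k1P].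
pose k := maxn k0 k1.
have he : h k <= e / 2.
  apply: le_trans (ltW k0e); rewrite ler_wiXn2l ?invr_ge0 ?invf_le1 ?ler1n //.
  exact: leq_maxl.
have := k1P k (leq_maxr _ _); rewrite /= -ball_normE /ball_ /= => zk.
have := qF k; apply: filterS => p; rewrite -!ball_normE /ball_ /= => qp.
rewrite -[_ - _](subrKA (q k)); apply: le_lt_trans (ler_normD _ _) _.
rewrite [e]splitr ltrD //; last exact: lt_le_trans qp he.
by rewrite -xq -qpiB; apply: le_lt_trans (qpi_norm _) zk.
Qed.

HB.instance Definition _ := Uniform_isComplete.Build quotLie quot_complete.

Definition qlie (p q : quotLie) : quotLie := qpi (lie (qrepr p) (qrepr q)).

Let lieDl x y z : lie (x + y) z = lie x z + lie y z :> L.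
Proof. by have := lie_linearl z 1 x y; rewrite !scale1r. Qed.

Let lieDr x y z : lie z (x + y) = lie z x + lie z y :> L.
Proof. by have := lie_linearr z 1 x y; rewrite !scale1r. Qed.

Let lieC x y : lie x y = - lie y x :> L.
Proof.
apply/eqP; rewrite -addr_eq0; apply/eqP.
by have := @lie_alt R L (x + y); rewrite lieDl !lieDr !lie_alt addr0 add0r.
Qed.

Lemma qpi_lie x y : qpi (lie x y) = qlie (qpi x) (qpi y).
Proof.
apply/esym/qpiP; set x' := qrepr _; set y' := qrepr _.
have xI : ideal_set I (x' - x) by apply/qpiP; rewrite qreprK.
have yI : ideal_set I (y' - y) by apply/qpiP; rewrite qreprK.
have -> : lie x' y' - lie x y = lie x' (y' - y) + lie (x' - x) y.
  have -> : lie x' y' = lie x' (y' - y) + lie x' y :> L by rewrite -lieDr subrK.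
  have -> : lie x' y = lie (x' - x) y + lie x y :> L by rewrite -lieDl subrK.
  by rewrite addrA addrK.
apply: idealD; first exact: (ideal_setP I).2.
by rewrite lieC -scaleN1r; apply/idealZ/(ideal_setP I).2.
Qed.

Let qlie_linearl z : linear (qlie ^~ z).
Proof.
have [z' <-] := qpi_surj z.
move=> a p q; have [x <-] := qpi_surj p; have [y <-] := qpi_surj q.
by rewrite -qpiZ -qpiD -!qpi_lie lie_linearl qpiD qpiZ.
Qed.

Let qlie_linearr z : linear (qlie z).
Proof.
have [z' <-] := qpi_surj z.
move=> a p q; have [x <-] := qpi_surj p; have [y <-] := qpi_surj q.
by rewrite -qpiZ -qpiD -!qpi_lie lie_linearr qpiD qpiZ.
Qed.

Let qlie_alt x : qlie x x = 0.
Proof. by have [y <-] := qpi_surj x; rewrite -qpi_lie lie_alt qpi0. Qed.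

Let qlie_jacobi x y z :
  qlie x (qlie y z) + qlie y (qlie z x) + qlie z (qlie x y) = 0.
Proof.
have [x' <-] := qpi_surj x; have [y' <-] := qpi_surj y.
have [z' <-] := qpi_surj z.
by rewrite -!qpi_lie -!qpiD lie_jacobi qpi0.
Qed.

Let qlie_bounded : exists2 t : R[i], 0 < t &
  forall x y, `|qlie x y| <= t * `|x| * `|y|.
Proof.
have [t t0 tP] := @lie_bounded R L; exists (t * 2 * 2); first by rewrite !mulr_gt0.
move=> p q; have [x <- xp] := qpi_lift p; have [y <- yq] := qpi_lift q.
rewrite -qpi_lie; apply: le_trans (qpi_norm _) _; apply: le_trans (tP _ _) _.
rewrite -[t * 2 * 2 * _]mulrA [2 * `|qpi x|]mulrC !mulrA -[_ * 2 * `|qpi y|]mulrA.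
rewrite ler_pM ?mulr_ge0 // ?(ltW t0) //.
by rewrite -mulrA ler_wpM2l ?(ltW t0) // mulrC.
Qed.

HB.instance Definition _ := isBanachLie.Build R quotLie
  qlie_linearl qlie_linearr qlie_alt qlie_jacobi qlie_bounded.

End QuotientAlgebra.

Section Families.
Context {R : realType} {V : completeNormedModType R[i]}.
Implicit Types (G C : set (set V)) (Y Z : set V).

Definition fam_cap G : set V := \bigcap_(Y in G) Y.

Definition fam_sum G : set V :=
  [set x | exists (n : nat) (Y : 'I_n -> set V) (y : 'I_n -> V),
     (forall i, G (Y i) /\ Y i (y i)) /\ x = \sum_(i < n) y i].

Definition fam_join G : set V := closure (fam_sum G).

Definition complete_family G : Prop :=
  forall G', G' !=set0 -> G' `<=` G -> G (fam_cap G') /\ G (fam_join G').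

(* [quot_dim Z Y n] is dim (Z / Y) = n, for subspaces Y `<=` Z: the classes of
   the [e i] form a basis of Z / Y. *)
Definition quot_dim Z Y (n : nat) : Prop :=
  exists2 e : 'I_n -> V, (forall i, Z (e i)) &
    forall z, Z z ->
      exists! c : {ffun 'I_n -> R[i]}, Y (z - \sum_(i < n) c i *: e i).

Definition lower_finite_gap G : Prop :=
  forall Z, G Z -> Z <> fam_cap G ->
    exists Y, [/\ G Y, Y `<=` Z & exists2 n, (0 < n)%N & quot_dim Z Y n].

Definition chain C : Prop :=
  (forall Y, C Y -> closed_subspace Y) /\
  (forall Y Z, C Y -> C Z -> Y `<=` Z \/ Z `<=` Y).

(* [fam_cap] and [fam_join] of an empty family are junk values, hence the
   non-emptiness condition. *)
Definition between C (A B : set V) : Prop :=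
  [/\ C !=set0, fam_cap C = A & fam_join C = B].

End Families.

Section Radicals.
Context {R : realType}.
Implicit Types L M : banachLieType R.

Definition lie_morphism {L M} (f : L -> M) : Prop :=
  [/\ linear f,
      forall x y, f (lie x y) = lie (f x) (f y),
      exists C : R[i], forall x, `|f x| <= C * `|x| &
      dense (range f)].

Definition preradical (P : forall L, closedIdeal L) : Prop :=
  forall L M (f : L -> M), lie_morphism f ->
    f @` ideal_set (P L) `<=` ideal_set (P M).

Definition upper_stable (P : forall L, closedIdeal L) : Prop :=
  forall L, ideal_set (P (quotLie (P L))) = [set 0].

Definition balanced (P : forall L, closedIdeal L) : Prop :=
  forall L (I : closedIdeal L),
    (val : idealLie I -> L) @` ideal_set (P (idealLie I)) `<=`
      ideal_set (P L).

Definition over_radical (P : forall L, closedIdeal L) : Prop :=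
  [/\ preradical P, upper_stable P & balanced P].

Definition strongly_F_semisimple L : Prop :=
  exists C : set (set L),
    [/\ forall I, C I -> closed_lie_ideal I,
        chain C,
        complete_family C,
        lower_finite_gap C &
        between C [set 0] setT].

Definition strongly_F_primitive L (I : closedIdeal L) : Prop :=
  strongly_F_semisimple (quotLie I).

Definition Fs_set L : set L :=
  [set x | forall I : closedIdeal L, strongly_F_primitive I -> ideal_set I x].

Lemma Fs_setP L : closed_lie_ideal (@Fs_set L).
Proof.
split; last first.
  by move=> a x xF I IF; apply: (ideal_setP I).2; exact: xF.
split; first split.
- by move=> I _; have [[[]]] := ideal_setP I.
- move=> a x y xF yF I IF; have [[[_ ID] _] _] := ideal_setP I.
  by apply: ID; [exact: xF|exact: yF].
- have -> : @Fs_set L =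
      \bigcap_(I in [set I : closedIdeal L | strongly_F_primitive I]) ideal_set I.
    by [].
  by apply: closed_bigI => I _; exact: (ideal_setP I).1.2.
Qed.

Definition Fs L : closedIdeal L := ClosedIdeal (@Fs_set L) (@Fs_setP L).

End Radicals.

(* Main.v *)
From mathcomp Require Import all_boot all_order all_algebra.
From mathcomp Require Import complex.
From mathcomp Require Import boolp classical_sets reals topology normedtype.
Require Import Defs.

Set Implicit Arguments.
Unset Strict Implicit.
Unset Printing Implicit Defensive.

Import Order.TTheory GRing.Theory Num.Theory.
Import numFieldNormedType.Exports.

Local Open Scope classical_set_scope.
Local Open Scope ring_scope.

(** Strong F-primitivity of I asks for a complete lower finite-gap chain of
    closed ideals in the quotient by I.  Chains are awkward to transport along
    homomorphisms and to combine, so they are first traded for the property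
    [finite_gaps I]: for every set A not contained in I there are closed ideals
    I <= Y <= Z with Z / Y finite-dimensional, A contained in Z but not in Y.
    The equivalence is [strongly_F_primitiveP].

    From a chain to gaps: let Z be the intersection of the members of the chain
    that contain the image of A.  It belongs to the chain and is not 0, so it
    has a finite-dimensional gap Y below it, and Y does not contain the image
    of A since Z is the least member that does.

    From gaps to a chain: every nonzero closed ideal Z of the quotient now has a
    closed ideal strictly below it of finite codimension, and such an ideal
    [next Z] can be chosen.  The smallest family that contains the whole algebra
    and is stable under [next] and under intersections is a chain, by the usual
    Bourbaki-Witt argument.  Each of its nonempty subfamilies has a greatest
    element, whence its stability under closed sums, and its least element is
    fixed by [next], hence is 0.

    The finite gap property pulls back along any bounded Lie homomorphism,
    because the preimages of Z and Y again differ by a finite dimension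
    ([quot_dim_pull]), and it passes to arbitrary intersections.  The first fact
    shows that the preimage of a strongly F-primitive ideal is strongly
    F-primitive, which gives both functoriality and, for the inclusion of an
    ideal, balance.  The second shows that [Fs L] is itself strongly
    F-primitive; then 0 is strongly F-primitive in the quotient by [Fs L], which
    is upper stability. *)

(** * Finite-dimensional quotients *)

Section Subspaces.
Context {R : realType} {V : completeNormedModType R[i]}.
Implicit Types (A Y Z : set V).

Lemma subspace0 A : subspace A -> A 0.
Proof. by case. Qed.

Lemma subspaceZ A a x : subspace A -> A x -> A (a *: x).
Proof. by move=> [A0 AL] Ax; rewrite -[_ *: _]addr0; exact: AL. Qed.

Lemma subspaceD A x y : subspace A -> A x -> A y -> A (x + y).
Proof. by move=> [A0 AL] Ax Ay; rewrite -[x]scale1r; exact: AL. Qed.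

Lemma subspaceB A x y : subspace A -> A x -> A y -> A (x - y).
Proof.
by move=> sA Ax Ay; apply: subspaceD => //; rewrite -scaleN1r; exact: subspaceZ.
Qed.

Lemma subspace_sum A n (y : 'I_n -> V) :
  subspace A -> (forall i, A (y i)) -> A (\sum_(i < n) y i).
Proof.
move=> sA Ay; apply: (big_ind A) => //; first exact: subspace0.
by move=> *; exact: subspaceD.
Qed.

Lemma closed_subspaceI A Z :
  closed_subspace A -> closed_subspace Z -> closed_subspace (A `&` Z).
Proof.
move=> [sA cA] [sZ cZ]; split; last exact: closedI.
split; first by split; exact: subspace0.
by move=> a x y [Ax Zx] [Ay Zy]; split; [exact: sA.2|exact: sZ.2].
Qed.

Lemma quot_dim_gt0 Z Y n z : quot_dim Z Y n -> Z z -> ~ Y z -> (0 < n)%N.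
Proof.
case: n => // -[e _ eP] Zz; have [c [+ _]] := eP z Zz.
by rewrite big_ord0 subr0.
Qed.

Lemma quot_dim_proper Z Y n :
  subspace Y -> subspace Z -> quot_dim Z Y n -> (0 < n)%N -> ~ Z `<=` Y.
Proof.
move=> sY sZ [e eZ eP] n0 ZY.
have [c [_ cP]] := eP 0 (subspace0 sZ).
(* If Z is contained in Y, every family of coefficients represents 0. *)
have all_c d : Y (0 - \sum_(i < n) d i *: e i).
  apply: ZY; apply: subspaceB (subspace0 sZ) _ => //.
  by apply: subspace_sum => // i; exact: subspaceZ.
have /ffunP/(_ (Ordinal n0)) := cP [ffun=> 1] (all_c _).
rewrite (cP [ffun=> 0] (all_c _)) !ffunE => /eqP.
by rewrite eq_sym oner_eq0.
Qed.

End Subspaces.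

(** A linear subspace of row vectors is the row space of a matrix of maximal
    rank among those with rows in it. *)
Lemma subspace_rV_rowspace (F : fieldType) n (S : set 'rV[F]_n) :
  S 0 -> (forall a u v, S u -> S v -> S (a *: u + v)) ->
  exists M : 'M[F]_n, forall u, S u <-> (u <= M)%MS.
Proof.
move=> S0 SL.
have S_sub m (M : 'M[F]_(m, n)) : (forall i, S (row i M)) ->
    forall u, (u <= M)%MS -> S u.
  move=> SM u /submxP[w ->]; rewrite mulmx_sum_row.
  apply: (big_ind S) => // [x y Sx Sy|i _]; first by rewrite -[x]scale1r; exact: SL.
  by rewrite -[_ *: _]addr0; exact: SL.
pose P k := `[< exists2 M : 'M[F]_n, (forall i, S (row i M)) & \rank M = k >].
have P0 : exists k, P k.
  by exists 0%N; apply/asboolP; exists 0; rewrite ?mxrank0 // => i; rewrite row0.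
have Pn k : P k -> (k <= n)%N.
  by move=> /asboolP[M _ <-]; exact: rank_leq_row.
have [k /asboolP[M SM Mk] kmax] := ex_maxnP P0 Pn.
exists M => u; split; last exact: S_sub.
move=> Su; apply: contraT => uM.
have /kmax : P (\rank (M + u)%MS).
  apply/asboolP; exists (M + u)%MS => // i.
  apply: (S_sub _ (col_mx M u)); last by rewrite -addsmxE row_sub.
  move=> j; case: (splitP j) => l jl.
    by rewrite (_ : j = lshift _ l) ?rowKu //; exact: val_inj.
  rewrite (_ : j = rshift _ l) ?rowKd //; last exact: val_inj.
  by rewrite (_ : row l u = u) //; apply/rowP => q; rewrite mxE ord1.
rewrite leqNgt -Mk => /negP[]; apply: rank_ltmx.
by rewrite ltmxE addsmxSl /= addsmx_sub submx_refl.
Qed.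

Section PullBack.
Context {R : realType} {U V : completeNormedModType R[i]}.

(** A subspace whose image lies in Z embeds modulo the preimage of Y in Z / Y,
    hence is finite-dimensional modulo it. *)
Lemma quot_dim_pull (f : U -> V) (Z Y : set V) (B : set U) n :
  linear f -> subspace Y -> subspace B -> B `<=` f @^-1` Z ->
  quot_dim Z Y n -> exists m, quot_dim B (B `&` f @^-1` Y) m.
Proof.
move=> fL sY sB BZ [e eZ eP].
(* S u x: u is the vector of coordinates of the class of f x in Z / Y. *)
pose S (u : 'rV[R[i]]_n) (x : U) := Y (f x - \sum_i u 0 i *: e i).
have SE u v x : B x -> S u x -> S v x -> u = v.
  move=> Bx Su Sv; have [c [_ cP]] := eP _ (BZ _ Bx).
  have H w : S w x -> [ffun i => w 0 i] = c.
    move=> Sw; apply/esym/cP; congr Y: Sw; congr (_ - _).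
    by apply: eq_bigr => i _; rewrite ffunE.
  apply/rowP => i; have := H _ Su; rewrite -(H _ Sv) => /ffunP/(_ i).
  by rewrite !ffunE.
have SL a u v x y : S u x -> S v y -> S (a *: u + v) (a *: x + y).
  rewrite /S => Su Sv; have := sY.2 a _ _ Su Sv; congr Y.
  rewrite fL scalerBr scaler_sumr addrACA -opprD -big_split /=.
  by congr (_ - _); apply: eq_bigr => i _; rewrite !mxE scalerDl scalerA.
have f0 : f 0 = 0.
  by have := fL (-1) 0 0; rewrite !scaleN1r oppr0 addr0 addNr.
have S0 x : Y (f x) <-> S 0 x.
  by rewrite /S big1 ?subr0 // => i _; rewrite mxE scale0r.
have Sex x : B x -> exists u, S u x.
  move=> Bx; have [c [Yc _]] := eP _ (BZ _ Bx).
  exists (\row_i c i); congr Y: Yc; congr (_ - _).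
  by apply: eq_bigr => i _; rewrite mxE.
have [M MP] : exists M : 'M_n, forall u,
    (exists2 x, B x & S u x) <-> (u <= M)%MS.
  apply: subspace_rV_rowspace.
    by exists 0; [exact: subspace0|apply/S0; rewrite f0; exact: subspace0].
  move=> a u v [x Bx Sx] [y By Sy].
  by exists (a *: x + y); [exact: sB.2|exact: SL].
(* Lift a basis of the space of coordinate vectors of elements of B. *)
have /choice[b bP] : forall i, exists x, B x /\ S (row i (row_base M)) x.
  move=> i; have /MP[x ? ?] : (row i (row_base M) <= M)%MS.
    by rewrite (submx_trans (row_sub _ _)) // eq_row_base.
  by exists x.
have Ssum (c : {ffun 'I_(\rank M) -> R[i]}) :
    S (\row_i c i *m row_base M) (\sum_i c i *: b i).
  rewrite mulmx_sum_row.
  apply: (big_ind2 S) => [|x u y v Sx Sy|i _].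
  - by apply/S0; rewrite f0; exact: subspace0.
  - by rewrite -[x]scale1r -[u]scale1r; exact: SL.
  - rewrite mxE -[_ *: row _ _]addr0 -[_ *: b _]addr0; apply: SL.
      exact: (bP i).2.
    by apply/S0; rewrite f0; exact: subspace0.
have Bsum (c : {ffun 'I_(\rank M) -> R[i]}) : B (\sum_i c i *: b i).
  by apply: subspace_sum => // i; apply: subspaceZ => //; exact: (bP i).1.
exists (\rank M), b; first by move=> i; exact: (bP i).1.
move=> z Bz; have [u Su] := Sex z Bz.
have /submxP[w uw] : (u <= row_base M)%MS.
  by rewrite eq_row_base; apply/MP; exists z.
(* c represents z modulo the preimage iff it gives the coordinates of f z. *)
have key (c : {ffun 'I_(\rank M) -> R[i]}) :
    (B `&` f @^-1` Y) (z - \sum_i c i *: b i) <->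
    u = \row_i c i *m row_base M.
  have Sd : S (u - \row_i c i *m row_base M) (z - \sum_i c i *: b i).
    by rewrite addrC -scaleN1r [z - _]addrC -[- \sum_i _]scaleN1r; exact: SL.
  have Bd : B (z - \sum_i c i *: b i) by exact: subspaceB.
  split=> [[_ /S0 S0d]|uE].
    by apply/eqP; rewrite -subr_eq0; apply/eqP; exact: SE Sd S0d.
  by split=> //; apply/S0; move: Sd; rewrite uE subrr.
exists [ffun i => w 0 i]; split.
  by apply/key; rewrite uw; congr (_ *m _); apply/rowP => i; rewrite mxE ffunE.
move=> c /key; rewrite uw => /(row_free_inj (row_base_free M)) wc.
by apply/ffunP => i; rewrite ffunE wc mxE.
Qed.

End PullBack.

(** * Separation by finite gaps *)

Section Ideals.
Context {R : realType}.
Implicit Types L M : banachLieType R.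

Lemma closed_lie_idealI L (I J : set L) :
  closed_lie_ideal I -> closed_lie_ideal J -> closed_lie_ideal (I `&` J).
Proof.
move=> [cI lI] [cJ lJ]; split; first exact: closed_subspaceI.
by move=> a x [/lI ? /lJ ?].
Qed.

Lemma closed_lie_ideal_cap L (G : set (set L)) :
  (forall Y, G Y -> closed_lie_ideal Y) -> closed_lie_ideal (fam_cap G).
Proof.
move=> GI; split; last by move=> a x Gx Y GY; apply: (GI _ GY).2; exact: Gx.
split; last by apply: closed_bigI => Y /GI[[]].
split; first by move=> Y /GI[[/subspace0]].
by move=> a x y Gx Gy Y GY; apply: (GI _ GY).1.1.2; [exact: Gx|exact: Gy].
Qed.

Lemma closed_lie_idealT L : closed_lie_ideal [set: L].
Proof. by split=> //; split=> //; exact: closedT. Qed.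

Lemma closed_lie_ideal0 L : closed_lie_ideal [set (0 : L)].
Proof.
split; last first.
  move=> a _ ->; rewrite /=; have := lie_linearr a (-1) 0 0.
  by rewrite scaler0 addr0 scaleN1r addNr.
split; last exact/accessible_closed_set1/hausdorff_accessible/norm_hausdorff.
by split=> // a _ _ -> ->; rewrite /= scaler0 addr0.
Qed.

Lemma closed_lie_ideal_preimage L M (f : L -> M) (C : R[i]) (J : set M) :
  linear f -> (forall x y, f (lie x y) = lie (f x) (f y)) ->
  (forall x, `|f x| <= C * `|x|) ->
  closed_lie_ideal J -> closed_lie_ideal (f @^-1` J).
Proof.
move=> fL flie fC [[sJ cJ] lJ]; split; last first.
  by move=> a x /= Jx; rewrite flie; exact: lJ.
have f0 : f 0 = 0.
  by have := fL (-1) 0 0; rewrite !scaleN1r oppr0 addr0 addNr.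
split.
  split; first by rewrite /= f0; exact: subspace0.
  by move=> a x y /= Jx Jy; rewrite fL; exact: sJ.2.
move=> x xJ; apply: cJ => B /nbhs_ballP[e /= e0 eB].
(* C may be 0, or not even real when L is trivial. *)
have C0 : 0 < `|C| + 1 by rewrite ltr_wpDl.
have [|y [Jy xy]] := xJ (ball x (e / (`|C| + 1))).
  by apply: nbhsx_ballx; rewrite divr_gt0.
exists (f y); split=> //; apply: eB.
move: xy; rewrite -!ball_normE /ball_ /= ltr_pdivlMr // => xy.
have -> : f x - f y = f (x - y).
  by have := fL (-1) y x; rewrite !scaleN1r [- y + x]addrC [_ + f x]addrC.
apply: le_lt_trans xy.
rewrite mulrDr mulr1; apply: (@le_trans _ _ (`|x - y| * `|C|)); last first.
  by rewrite lerDl.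
rewrite mulrC -[`|x - y|]normr_id -normrM ger0_norm ?fC //.
exact: le_trans (normr_ge0 _) (fC _).
Qed.

(** Every set not contained in J is separated from J by a pair of closed ideals
    Y, Z differing by a finite dimension.  The set A is arbitrary: along the
    inclusion of an ideal K of L, the ideals of K to be separated need not be
    ideals of L. *)
Definition finite_gaps L (J : set L) : Prop :=
  forall A : set L, ~ A `<=` J -> exists Y Z : set L,
    [/\ closed_lie_ideal Y /\ closed_lie_ideal Z, J `<=` Y /\ Y `<=` Z,
        A `<=` Z, ~ A `<=` Y & exists n, quot_dim Z Y n].

Lemma finite_gaps_preimage L M (f : L -> M) (C : R[i]) (J : set M) :
  linear f -> (forall x y, f (lie x y) = lie (f x) (f y)) ->
  (forall x, `|f x| <= C * `|x|) ->
  finite_gaps J -> finite_gaps (f @^-1` J).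
Proof.
move=> fL flie fC gJ A AJ.
have [|Y [Z [[iY iZ] [JY YZ] AZ AY [n ZY]]]] := gJ (f @` A).
  by apply: contra_not AJ => AJ x Ax; apply: AJ; exists x.
have iY' : closed_lie_ideal (f @^-1` Y) by exact: closed_lie_ideal_preimage fC iY.
have iZ' : closed_lie_ideal (f @^-1` Z) by exact: closed_lie_ideal_preimage fC iZ.
exists (f @^-1` Y), (f @^-1` Z); split=> //.
- by split=> x; [exact: JY|exact: YZ].
- by move=> x Ax; apply: AZ; exists x.
- by apply: contra_not AY => AY _ [x Ax <-]; exact: AY.
have -> : f @^-1` Y = f @^-1` Z `&` f @^-1` Y.
  by apply/esym/setIidr => x; exact: YZ.
exact: (quot_dim_pull fL iY.1.1 iZ'.1.1 _ ZY).
Qed.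

Lemma finite_gaps_bigcap L (I : Type) (D : set I) (J : I -> set L) :
  (forall i, D i -> finite_gaps (J i)) -> finite_gaps (\bigcap_(i in D) J i).
Proof.
move=> gJ A AJ; have [i Di AJi] : exists2 i, D i & ~ A `<=` J i.
  apply: contrapT => H; apply: AJ => x Ax i Di; apply: contrapT => Jx.
  by apply: H; exists i => // /(_ x Ax).
have [Y [Z [iYZ [JY YZ] AZ AY dYZ]]] := gJ i Di A AJi.
by exists Y, Z; split=> //; split=> // x Jx; apply: JY; exact: Jx.
Qed.

End Ideals.

(** * Strong primitivity amounts to finite gaps *)

Section Quotient.
Context {R : realType} {L : banachLieType R} (I : closedIdeal L).

Let pi := @qpi R L I.

Lemma qpi_linear : linear pi.
Proof. by move=> a x y; rewrite /pi qpiD qpiZ. Qed.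

Let pi0 : pi 0 = 0.
Proof. by have := qpiZ I 0 0; rewrite !scale0r. Qed.

Lemma qpi_eq0 x : pi x = 0 <-> ideal_set I x.
Proof. by rewrite -pi0 qpiP subr0. Qed.

Lemma quot_dim_qpi (Z Y : set L) n : subspace Y -> ideal_set I `<=` Y ->
  quot_dim Z Y n -> quot_dim (pi @` Z) (pi @` Y) n.
Proof.
move=> sY IY [e eZ eP]; exists (pi \o e); first by move=> i; exists (e i).
move=> _ [z Zz <-].
have key (c : {ffun 'I_n -> R[i]}) :
    (pi @` Y) (pi z - \sum_i c i *: (pi \o e) i) <-> Y (z - \sum_i c i *: e i).
  have -> : pi z - \sum_i c i *: (pi \o e) i = pi (z - \sum_i c i *: e i).
    rewrite [RHS]qpiB; congr (_ - _); rewrite -/pi (big_morph pi (@qpiD _ _ I) pi0).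
    by apply: eq_bigr => i _; rewrite /= -qpiZ.
  split=> [[y Yy /esym/qpiP/IY h]|]; last by exists (z - \sum_i c i *: e i).
  by rewrite -[_ - \sum_i _](subrK y); exact: subspaceD.
have [c [Yc cP]] := eP z Zz.
by exists c; split=> [|d /key]; [exact/key|exact: cP].
Qed.

Lemma closed_lie_ideal_qpi (Z : set L) : ideal_set I `<=` Z ->
  closed_lie_ideal Z -> closed_lie_ideal (pi @` Z).
Proof.
move=> IZ [[sZ cZ] lZ]; split; last first.
  move=> a _ [x Zx <-]; have [b <-] := qpi_surj a.
  by exists (lie b x); [exact: lZ|exact: qpi_lie].
split.
  split; first by exists 0; first exact: subspace0.
  move=> a _ _ [x Zx <-] [y Zy <-].
  by exists (a *: x + y); [exact: sZ.2|exact: qpi_linear].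
move=> q qZ; have [x xq] := qpi_surj q; exists x => //.
apply: cZ => B /nbhs_ballP[e /= e0 eB].
have [|_ [[z Zz <-] qz]] := qZ (ball q (e / 2)).
  by apply: nbhsx_ballx; rewrite divr_gt0.
(* Lifting q - pi z to a vector of norm at most twice as large yields a point
   of Z near x. *)
have [w wq we] := qpi_lift (q - pi z).
exists (x - w); split.
  rewrite -[x - w](subrK z); apply: subspaceD => //; apply: IZ; apply/qpi_eq0.
  by rewrite /pi !qpiB wq xq subKr subrr.
apply: eB; move: qz; rewrite -!ball_normE /ball_ /= subKr.
by rewrite ltr_pdivlMr // mulrC; exact: le_lt_trans.
Qed.

Lemma finite_gaps_qpi : finite_gaps (ideal_set I) ->
  finite_gaps [set (0 : quotLie I)].
Proof.
move=> gI A A0.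
have [|Y [Z [[iY iZ] [IY YZ] AZ AY [n ZY]]]] := gI (pi @^-1` A).
  apply: contra_not A0 => AI q Aq; have [x xq] := qpi_surj q.
  by rewrite /= -xq; apply/qpi_eq0/AI; rewrite /= /pi xq.
exists (pi @` Y), (pi @` Z); split.
- by split; apply: closed_lie_ideal_qpi => //; exact: subset_trans YZ.
- split; last exact: image_subset.
  by move=> _ ->; exists 0; first exact: subspace0 iY.1.1.
- move=> q Aq; have [x xq] := qpi_surj q; exists x => //.
  by apply: AZ; rewrite /= /pi xq.
- apply: contra_not AY => AY x /AY[y Yy /esym/qpiP/IY h].
  by rewrite -[x](subrK y); apply: subspaceD => //; exact: iY.1.1.
by exists n; exact: quot_dim_qpi iY.1.1 IY ZY.
Qed.

End Quotient.

Section Characterization.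
Context {R : realType}.
Implicit Types L : banachLieType R.

Lemma strongly_F_semisimple_finite_gaps0 L :
  strongly_F_semisimple L -> finite_gaps [set (0 : L)].
Proof.
move=> [C [iC cC kC gC [[Y0 CY0] C0 CT]]] A A0.
have CsetT : C setT.
  by rewrite -CT; apply: (kC C _ _).2 => //; exists Y0.
(* Z is the least member of C containing A. *)
pose G := [set Y | C Y /\ A `<=` Y]; pose Z := fam_cap G.
have CZ : C Z by apply: (kC G _ _).1; [exists setT|move=> Y []].
have AZ : A `<=` Z by move=> x Ax Y [_]; exact.
have [|Y [CY YZ [n n0 ZY]]] := gC Z CZ.
  by rewrite C0 => Z0; apply: A0; rewrite -Z0.
exists Y, Z; split=> //.
- by split; exact: iC.
- by split=> // _ ->; exact: subspace0 (iC _ CY).1.1.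
- move=> AY; apply: (quot_dim_proper _ _ ZY n0); try exact: (iC _ _).1.1.
  by move=> x; exact.
by exists n.
Qed.

Section Tower.
Variables (L : banachLieType R) (next : set L -> set L).
Hypothesis next_sub : forall Z, next Z `<=` Z.

(** The smallest family of sets that contains the whole space and is stable
    under [next] and under nonempty intersections. *)
Inductive tower : set L -> Prop :=
| tower_top : tower setT
| tower_next Z : tower Z -> tower (next Z)
| tower_cap G : G !=set0 -> (forall Y, G Y -> tower Y) -> tower (fam_cap G).

(* Nothing in the tower jumps over a pivot Z: a member strictly above Z remains
   above Z after one step.  A pivot is comparable with the whole tower, and it
   follows in turn that all members are pivots. *)
Let pivot Z := forall X, tower X -> Z `<=` X -> X <> Z -> Z `<=` next X.

Let pivot_cmp Z : pivot Z -> forall X, tower X -> X `<=` next Z \/ Z `<=` X.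
Proof.
move=> pZ X; elim=> [|{}X tX [XZ|ZX]|G _ tG IH].
- by right.
- by left; apply: subset_trans XZ.
- have [->|/eqP XZ] := pselect (X = Z); first by left.
  by right; apply: pZ => //; exact/eqP.
- have [[Y GY YZ]|H] := pselect (exists2 Y, G Y & Y `<=` next Z).
    by left=> x /(_ Y GY)/YZ.
  right=> x Zx Y GY; have [YZ|] := IH Y GY; last exact.
  by case: H; exists Y.
Qed.

Let tower_pivot Z : tower Z -> pivot Z.
Proof.
elim=> [|{}Z tZ pZ|G _ tG IH] X tX ZX XZ.
- by case: XZ; apply/seteqP; split.
- have [XnZ|ZX'] := pivot_cmp pZ tX; first by case: XZ; apply/seteqP.
  have [->//|XZ'] := pselect (X = Z).
  by apply: subset_trans (@next_sub Z) _; exact: pZ.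
- have [Y GY XY] : exists2 Y, G Y & ~ X `<=` Y.
    apply: contrapT => H; apply: XZ; apply/seteqP; split=> // x Xx Y GY.
    by apply: contrapT => Yx; apply: H; exists Y => // /(_ x Xx).
  have [XnY|YX] := pivot_cmp (IH Y GY) tX.
    by case: XY; exact: subset_trans (@next_sub Y).
  apply: (@subset_trans _ Y) => [x|]; first exact.
  by apply: IH => // XYE; apply: XY; rewrite XYE.
Qed.

Lemma tower_cmp Z X : tower Z -> tower X -> X `<=` next Z \/ Z `<=` X.
Proof. by move=> tZ; exact/pivot_cmp/tower_pivot. Qed.

End Tower.

(** The tower of chosen finite-codimensional closed ideals is the required
    chain. *)
Lemma finite_gaps0_strongly_F_semisimple L :
  finite_gaps [set (0 : L)] -> strongly_F_semisimple L.
Proof.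
move=> gL.
have /choice[next nextP] : forall Z : set L, exists Y : set L, Y `<=` Z /\
    (closed_lie_ideal Z -> closed_lie_ideal Y /\
      (Z <> [set 0] -> ~ Z `<=` Y /\ exists n, quot_dim Z Y n)).
  move=> Z; have [iZ|niZ] := pselect (closed_lie_ideal Z); last by exists Z; split.
  have [->|Z0] := pselect (Z = [set 0]).
    by exists [set 0]; split=> // ?; split.
  have [|Y [X [[iY iX] [_ YX] ZX ZY [n XY]]]] := gL Z.
    move=> Zs; apply: Z0; apply/seteqP; split=> // _ ->.
    exact: subspace0 iZ.1.1.
  exists (Z `&` Y); split=> [x []//|_]; split; first exact: closed_lie_idealI.
  move=> _; split; first by apply: contra_not ZY => ZY x /ZY[].
  exact: (@quot_dim_pull _ L L id X Y Z n (fun _ _ _ => erefl) iY.1.1 iZ.1.1 ZX XY).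
have next_sub Z : next Z `<=` Z by exact: (nextP Z).1.
pose T := tower next.
have iT Z : T Z -> closed_lie_ideal Z.
  elim=> [|{}Z _ /(nextP Z).2[]//|G _ _]; first exact: closed_lie_idealT.
  exact: closed_lie_ideal_cap.
have T0 Z : T Z -> Z 0 by move=> /iT[[[]]].
have T_next Z : T Z -> Z `<=` next Z -> Z = [set 0].
  move=> /iT iZ Zn; apply: contrapT => Z0.
  by have [] := ((nextP Z).2 iZ).2 Z0.
have capT : fam_cap T = [set 0].
  have TT : T (fam_cap T).
    by apply: tower_cap => //; exists setT; exact: tower_top.
  by apply: T_next => // x; apply; exact: tower_next.
exists T; split.
- exact: iT.
- split=> [Y /iT[]//|Y Z TY TZ].
  have [YZ|] := tower_cmp next_sub TZ TY; last by right.
  by left; exact: subset_trans (next_sub Z).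
- move=> G G0 GT; split; first exact: tower_cap.
  (* The least member of the tower containing all of G belongs to G. *)
  pose Z := fam_cap [set Y | T Y /\ forall X, G X -> X `<=` Y].
  have TZ : T Z.
    by apply: tower_cap => [|Y []//]; exists setT; split=> //; exact: tower_top.
  have GZ X : G X -> X `<=` Z by move=> GX x Xx Y [_ /(_ X GX)]; exact.
  have ZG : G Z.
    apply: contrapT => nGZ.
    (* Otherwise next Z contains all of G too, so that Z = 0; but then the
       members of G, which lie between 0 and Z, are all equal to Z. *)
    have Zn : Z `<=` next Z.
      move=> x; apply; split; first exact: tower_next.
      move=> X GX; have [//|ZX] := tower_cmp next_sub TZ (GT X GX).
      by case: nGZ; rewrite (_ : Z = X) //; apply/seteqP; split=> //; exact: GZ.
    have [X GX] := G0; apply: nGZ; rewrite (_ : Z = X) //.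
    apply/seteqP; split; last exact: GZ.
    by rewrite (T_next Z TZ Zn) => _ ->; apply: T0; exact: GT.
  suff -> : fam_join G = Z by [].
  apply/seteqP; split.
    have /closure_id -> := (iT Z TZ).1.2.
    apply: closure_subset => _ [n [Y [y [yP ->]]]].
    apply: subspace_sum (iT Z TZ).1.1 _ => i.
    by have [GY] := yP i; exact: GZ.
  move=> x Zx; apply: subset_closure.
  by exists 1%N, (fun=> Z), (fun=> x); rewrite big_ord1; split.
- rewrite /lower_finite_gap capT => Z TZ Z0.
  have [_ /(_ Z0)[Zn [n dn]]] := (nextP Z).2 (iT Z TZ).
  exists (next Z); split=> //; first exact: tower_next.
  exists n => //; have [z [Zz nz]] : exists z, Z z /\ ~ next Z z.
    apply: contrapT => H; apply: Zn => z Zz; apply: contrapT => nz.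
    by apply: H; exists z.
  exact: quot_dim_gt0 dn Zz nz.
- split=> //; first by exists setT; exact: tower_top.
  apply/seteqP; split=> // x _; apply: subset_closure.
  exists 1%N, (fun=> setT), (fun=> x); rewrite big_ord1; split=> // _.
  by split=> //; exact: tower_top.
Qed.

Lemma strongly_F_primitiveP L (I : closedIdeal L) :
  strongly_F_primitive I <-> finite_gaps (ideal_set I).
Proof.
split=> [/strongly_F_semisimple_finite_gaps0 gI|gI]; last first.
  exact/finite_gaps0_strongly_F_semisimple/finite_gaps_qpi.
have -> : ideal_set I = @qpi R L I @^-1` [set 0].
  by apply/seteqP; split=> x; [move/qpi_eq0|move=> ?; exact/qpi_eq0].
apply: (finite_gaps_preimage (qpi_linear I) (qpi_lie I) (C := 1)) gI => x.
by rewrite mul1r; exact: qpi_norm.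
Qed.

End Characterization.

(** * The over radical *)

Section Radical.
Context {R : realType}.
Implicit Types L M : banachLieType R.

Lemma finite_gaps_Fs L : finite_gaps (ideal_set (Fs L)).
Proof.
suff : finite_gaps (\bigcap_(I in [set I : closedIdeal L | strongly_F_primitive I])
    ideal_set I) by [].
by apply: finite_gaps_bigcap => I /strongly_F_primitiveP.
Qed.

(** Density of the range is irrelevant here, so the same lemma serves for
    morphisms and for the inclusion of an ideal. *)
Lemma Fs_image L M (f : L -> M) (C : R[i]) :
  linear f -> (forall x y, f (lie x y) = lie (f x) (f y)) ->
  (forall x, `|f x| <= C * `|x|) ->
  f @` ideal_set (Fs L) `<=` ideal_set (Fs M).
Proof.
move=> fL flie fC _ [x Fx <-] J /strongly_F_primitiveP gJ.
have iJ := closed_lie_ideal_preimage fL flie fC (ideal_setP J).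
apply: (Fx (ClosedIdeal _ iJ)); apply/strongly_F_primitiveP.
exact: finite_gaps_preimage fL flie fC gJ.
Qed.

End Radical.

Theorem theorem8p23 (R : realType) : over_radical (@Fs R).
Proof.
split.
- by move=> L M f [fL flie [C fC] _]; exact: Fs_image fL flie fC.
- move=> L; apply/seteqP; split; last first.
    by move=> _ ->; exact: subspace0 (ideal_setP _).1.1.
  have g0 := finite_gaps_qpi (@finite_gaps_Fs R L).
  pose O := ClosedIdeal _ (closed_lie_ideal0 (quotLie (Fs L))).
  by move=> x /(_ O); apply; exact/strongly_F_primitiveP.
- move=> L I; apply: (Fs_image (C := 1)) => // x.
  by rewrite mul1r idealLie_normE.
Qed.
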